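(* Consider the semi-discrete finite volume scheme for the MHD equations with GLM divergence cleaning defined in the context, and let $\{\mathbf{q}^\ell(t)\}_\ell$ be a (differentiable in time) solution of it with $\rho^\ell>0$. Assume that the temperature is positive, $T^\ell>0$, and that for every pair of neighbouring cells the averaged Hessian of the energy potential $\boldsymbol{\mathcal H}^{\ell r}=\partial^2_{\mathbf{q}\mathbf{q}}\mathcal{E}^{\ell r}$ is at least positive semi-definite. Then in every cell $\Omega^\ell$ the scheme satisfies the cell entropy inequality $$\frac{\partial (\rho S)^\ell}{\partial t}+\sum_{r\in N_\ell}\frac{|\partial\Omega^{\ell r}|}{|\Omega^\ell|}\,D_{\rho S}^{\ell r,-}-\sum_{r\in N_\ell}\frac{|\partial\Omega^{\ell r}|}{|\Omega^\ell|}\,g_{\rho S,\mathbf{n}}^{\ell r}\;\ge\;0 .$$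
   Context: **Conventions.** Repeated indices are summed. Velocity $\mathbf v=(v_1,v_2,v_3)$ and magnetic field $\mathbf B=(B_1,B_2,B_3)$ have three components, space is two-dimensional, and normals have third component $n_3=0$. Constants: $\gamma>1$, $c_v>0$, $c_h\ge 0$. **State and energy.** $\mathbf q=(\rho,\rho v_i,\rho S,B_i,\varphi)$ with $\rho>0$. The total energy density is, as a function of $\mathbf q$, $\mathcal E=\mathcal E_1+\mathcal E_2+\mathcal E_3+\mathcal E_4$ with $\mathcal E_1=\frac{\rho^\gamma}{\gamma-1}e^{S/c_v}$, $\mathcal E_2=\frac12\rho v_iv_i$, $\mathcal E_3=\frac12B_mB_m$, $\mathcal E_4=\frac12\rho\varphi^2$. Put $E_4=\mathcal E_4/\rho=\frac12\varphi^2$. The hydrodynamic pressure is $p=\rho^\gamma e^{S/c_v}$ and the temperature is $T=\partial_{\rho S}\mathcal E=\frac{\rho^{\gamma-1}}{(\gamma-1)c_v}e^{S/c_v}$. **Mesh.** A bounded polygonal domain is divided into cells $\Omega^\ell$ with circumcenters $\mathbf x^\ell$; $N_\ell$ is the set of neighbours of $\Omega^\ell$ (across a boundary face the neighbour is a ghost cell with a given state). For $r\in N_\ell$, $\partial\Omega^{\ell r}$ is the shared face, $|\partial\Omega^{\ell r}|$ its length, $|\Omega^\ell|$ the cell area, $\mathbf n^{\ell r}=-\mathbf n^{r\ell}$ the unit normal pointing from $\mathbf x^\ell$ to $\mathbf x^r$, and $\delta^{\ell r}=\|\mathbf x^r-\mathbf x^\ell\|>0$. A superscript $\ell$ means evaluation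 at $\mathbf q^\ell$. **Scheme.** For each cell, with all sums over $r\in N_\ell$, $$\frac{\partial\rho^\ell}{\partial t}=\frac1{|\Omega^\ell|}\sum_r|\partial\Omega^{\ell r}|\left(-D_\rho^{\ell r,-}+g_{\rho,\mathbf n}^{\ell r}\right),$$ $$\frac{\partial(\rho v_i)^\ell}{\partial t}=\frac1{|\Omega^\ell|}\sum_r|\partial\Omega^{\ell r}|\left(-D_{\rho v_i}^{\ell r,-}-(\mu^{\ell r}-\mu^\ell)n_i^{\ell r}-(R_{ik}^{\ell r}-R_{ik}^\ell)n_k^{\ell r}+g_{\rho v_i,\mathbf n}^{\ell r}\right),$$ $$\frac{\partial(\rho S)^\ell}{\partial t}=\frac1{|\Omega^\ell|}\sum_r|\partial\Omega^{\ell r}|\left(-D_{\rho S}^{\ell r,-}+g_{\rho S,\mathbf n}^{\ell r}+\Pi_{\mathbf n}^{\ell r,-}\right),$$ $$\frac{\partial B_i^\ell}{\partial t}=\frac1{|\Omega^\ell|}\sum_r|\partial\Omega^{\ell r}|\left(-\mathcal D_{B_i}^{\ell r,-}-c_h(\varphi^{\ell r}-\varphi^\ell)n_i^{\ell r}+g_{B_i,\mathbf n}^{\ell r}\right),$$ $$\frac{\partial\varphi^\ell}{\partial t}=\frac1{|\Omega^\ell|}\sum_r|\partial\Omega^{\ell r}|\left(-\tfrac12\tilde u^{\ell r}(\varphi^r-\varphi^\ell)-\tfrac{c_h}{\rho^{\ell r}}\tfrac12(B_k^r-B_k^\ell)n_k^{\ell r}+g_{\varphi,\mathbf n}^{\ell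 r}\right),$$ where: - *Euler fluctuations.* $\mathbf f_k=(\rho v_k,\ \rho v_iv_k+p\,\delta_{ik},\ \rho Sv_k)$ is the Euler flux in direction $k=1,2$, a function of $\mathbf w=(\rho,\rho v_i,\rho S)$. The map $\mathbf w\mapsto\boldsymbol\pi=\partial_{\mathbf w}(\mathcal E_1+\mathcal E_2)=(\partial_\rho(\mathcal E_1+\mathcal E_2),v_i,T)$ is a bijection from $\{\rho>0\}$ onto $\{T>0\}$. The face flux is the exact path integral $\mathbf f_k^{\ell r}=\int_0^1\mathbf f_k\big(\mathbf w(\boldsymbol\pi^\ell+s(\boldsymbol\pi^r-\boldsymbol\pi^\ell))\big)\,ds$, with components $f_{\rho,k}^{\ell r},f_{\rho v_i,k}^{\ell r},f_{\rho S,k}^{\ell r}$, and $D_a^{\ell r,-}=(f_{a,k}^{\ell r}-f_{a,k}^\ell)n_k^{\ell r}$ for $a\in\{\rho,\rho v_i,\rho S\}$. - *Dissipation.* $\Delta\mathbf q^{\ell r}=\mathbf q^r-\mathbf q^\ell$, and $g_{a,\mathbf n}^{\ell r}=\epsilon^{\ell r}\frac{a^r-a^\ell}{\delta^{\ell r}}$ for each component $a$ of $\mathbf q$, with scalar viscosity $\epsilon^{\ell r}=\epsilon^{r\ell}\ge0$. - *Entropy production.* $\Pi_{\mathbf n}^{\ell r,-}=\frac12\epsilon^{\ell r}\frac{1}{T^\ell}\Delta\mathbf q^{\ell r}\cdot\partial^2_{\mathbf q\mathbf q}\mathcal E^{\ell r}\frac{\Delta\mathbf q^{\ell r}}{\delta^{\ell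 r}}$, with $\partial^2_{\mathbf q\mathbf q}\mathcal E^{\ell r}=\int_0^1\partial^2_{\mathbf q\mathbf q}\mathcal E(\mathbf q^\ell+s\,\Delta\mathbf q^{\ell r})\,ds$ the Hessian of $\mathcal E$ averaged along the segment. - *Magnetic terms.* $\mu=\frac12B_mB_m$, $R_{ik}=-B_iB_k$, $\mu^{\ell r}=\frac12(\mu^\ell+\mu^r)$, $R_{ik}^{\ell r}=-\frac12(B_i^\ell+B_i^r)\,\frac12(B_k^\ell+B_k^r)$, $v_i^{\ell r}=\frac12(v_i^\ell+v_i^r)$, $(v_iB_k)^{\ell r}=\frac12\big((v_iB_k)^\ell+(v_iB_k)^r\big)$, $(B_iv_k)^{\ell r}=\frac12(B_i^\ell+B_i^r)\,\frac12(v_k^\ell+v_k^r)$, and $\mathcal D_{B_i}^{\ell r,-}=\big((B_iv_k)^{\ell r}-(B_iv_k)^\ell\big)n_k^{\ell r}-\big((v_iB_k)^{\ell r}-(v_iB_k)^\ell\big)n_k^{\ell r}+\frac12v_i^{\ell r}(B_k^r-B_k^\ell)n_k^{\ell r}$. - *Cleaning terms.* $\rho^{\ell r}=\frac12(\rho^\ell+\rho^r)$, $\varphi^{\ell r}=\frac{\rho^\ell\varphi^\ell+\rho^r\varphi^r}{\rho^\ell+\rho^r}$, and $\tilde u^{\ell r}=\dfrac{f_{\rho,k}^{\ell r}n_k^{\ell r}(E_4^r-E_4^\ell)}{\frac12\big((\rho\varphi)^\ell+(\rho\varphi)^r\big)(\varphi^r-\varphi^\ell)}$ if the denominator is nonzero,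 and otherwise $\tilde u^{\ell r}=v_k^{\ell r}n_k^{\ell r}$. *)

(* Defs.v *)
From HB Require Import structures.
From mathcomp Require Import all_boot all_order all_algebra.
From mathcomp Require Import all_classical all_reals all_analysis.
Set Implicit Arguments.
Unset Strict Implicit.
Unset Printing Implicit Defensive.
Import Order.TTheory GRing.Theory Num.Theory.
Import numFieldNormedType.Exports.
Local Open Scope classical_set_scope.
Local Open Scope ring_scope.

Section Geometry.
Context {R : realType}.

Definition dist2 (x y : R * R) : R :=
  Num.sqrt ((x.1 - y.1) ^+ 2 + (x.2 - y.2) ^+ 2).

(* Convex hull of a finite list of points. *)
Definition hull (vs : seq (R * R)) : set (R * R) :=
  [set x | exists w : 'I_(size vs) -> R,
     [/\ forall i, 0 <= w i, \sum_i w i = 1,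
         x.1 = \sum_i w i * (nth x vs i).1
       & x.2 = \sum_i w i * (nth x vs i).2]].

Definition segment (e : (R * R) * (R * R)) : set (R * R) := hull [:: e.1; e.2].

Definition area (A : set (R * R)) : R :=
  fine ((@lebesgue_measure R \x @lebesgue_measure R)%E A).

End Geometry.

(* A polygonal mesh with circumcenters.  The elements of [ghost] are the ghost
   cells; a ghost cell has a center but no shape.  A simple polygon inscribed in
   a circle is the convex hull of its vertices. *)
Record mesh (R : realType) := Mesh {
  cell : finType;
  ghost : finType;
  vertices : cell -> seq (R * R);
  center : cell + ghost -> R * R;
  nbr : cell -> {set cell + ghost};
  (* end points of the face between a cell and one of its neighbours *)
  face : cell -> cell + ghost -> (R * R) * (R * R);
  region := fun l : cell => hull (vertices l);
  domain := (\bigcup_(l in [set: cell]) region l)°;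
  vertices_uniq : forall l, uniq (vertices l) /\ (3 <= size (vertices l))%N;
  circumcenter : forall l, exists2 rad : R, 0 < rad &
    {in vertices l, forall x, dist2 x (center (inl l)) = rad};
  domain_nonempty : domain !=set0;
  domain_connected : connected domain;
  region_disjoint : forall l r : cell, l != r ->
    (region l)° `&` (region r)° = set0;
  nbr_irrefl : forall l, inl l \notin nbr l;
  nbr_sym : forall l r : cell, (inl r \in nbr l) = (inl l \in nbr r);
  ghost_owner : forall g : ghost, exists! l, inr g \in nbr l;
  face_nondegenerate : forall l r, r \in nbr l -> (face l r).1 <> (face l r).2;
  face_interior : forall l r : cell, inl r \in nbr l ->
    segment (face l (inl r)) = region l `&` region r;
  face_boundary : forall (l : cell) (g : ghost), inr g \in nbr l ->
    segment (face l (inr g)) `<=` closure domain `\` domain;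
  face_cover : forall l,
    \bigcup_(r in [set r | r \in nbr l]) segment (face l r)
      = region l `\` (region l)°;
  face_overlap : forall l r s, r \in nbr l -> s \in nbr l -> r != s ->
    is_subset1 (segment (face l r) `&` segment (face l s));
  center_neq : forall l r, r \in nbr l -> center (inl l) <> center r;
  (* a face is orthogonal to the line joining the two centers *)
  face_orthogonal : forall l r, r \in nbr l ->
    ((face l r).2.1 - (face l r).1.1) * ((center r).1 - (center (inl l)).1)
    + ((face l r).2.2 - (face l r).1.2) * ((center r).2 - (center (inl l)).2)
    = 0
}.

Definition allcell (R : realType) (M : mesh R) : Type := (cell M + ghost M)%type.

Section MeshQuantities.
Context {R : realType} (M : mesh R).
Implicit Types (l : cell M) (r : allcell M).

Definition cell_area l : R := area (region l).

Definition face_length l r : R := dist2 (face l r).1 (face l r).2.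

Definition cdist (l r : allcell M) : R := dist2 (center r) (center l).

Definition normal (l r : allcell M) (i : 'I_3) : R :=
  match val i with
  | 0%N => ((center r).1 - (center l).1) / cdist l r
  | 1%N => ((center r).2 - (center l).2) / cdist l r
  | _ => 0
  end.

End MeshQuantities.

(* The state (rho, rho v_1..3, rho S, B_1..3, varphi) is a row vector of length
   9, and its hydrodynamic part (rho, rho v_1..3, rho S) one of length 5. *)
Section Model.
Context {R : realType}.
Variables gamma cv ch : R.

Let state := 'rV[R]_9.
Let hydro := 'rV[R]_5.

Definition j_rho {n} : 'I_n.+1 := ord0.
Definition j_mom {n} (i : 'I_3) : 'I_n.+1 := inord (1 + i).
Definition j_rhoS {n} : 'I_n.+1 := inord 4.
Definition j_B (i : 'I_3) : 'I_9 := inord (5 + i).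
Definition j_phi : 'I_9 := inord 8.

Definition hydro_part (q : state) : hydro :=
  \row_(j < 5) q 0 (inord j).

Definition rho {n} (q : 'rV[R]_n.+1) : R := q 0 j_rho.
Definition mom {n} (q : 'rV[R]_n.+1) (i : 'I_3) : R := q 0 (j_mom i).
Definition rhoS {n} (q : 'rV[R]_n.+1) : R := q 0 j_rhoS.
Definition vel {n} (q : 'rV[R]_n.+1) (i : 'I_3) : R := mom q i / rho q.
Definition ent {n} (q : 'rV[R]_n.+1) : R := rhoS q / rho q.
Definition mag (q : state) (i : 'I_3) : R := q 0 (j_B i).
Definition phi (q : state) : R := q 0 j_phi.

Definition E1 (w : hydro) : R :=
  rho w `^ gamma / (gamma - 1) * expR (ent w / cv).
Definition E2 (w : hydro) : R := 2^-1 * rho w * \sum_(i < 3) vel w i * vel w i.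
Definition E3 (q : state) : R := 2^-1 * \sum_(m < 3) mag q m * mag q m.
Definition E4 (q : state) : R := 2^-1 * rho q * phi q ^+ 2.
Definition energy (q : state) : R :=
  E1 (hydro_part q) + E2 (hydro_part q) + E3 q + E4 q.
Definition e4 (q : state) : R := E4 q / rho q.

Definition pressure (w : hydro) : R := rho w `^ gamma * expR (ent w / cv).

Definition partial {n} (j : 'I_n) (f : 'rV[R]_n -> R) (x : 'rV[R]_n) : R :=
  'D_(delta_mx 0 j) f x.

Definition temperature (q : state) : R := partial j_rhoS energy q.

Definition hessian {n} (f : 'rV[R]_n -> R) (x : 'rV[R]_n) : 'M[R]_n :=
  \matrix_(i, j) partial j (partial i f) x.

Definition psd {n} (H : 'M[R]_n) : Prop :=
  forall x : 'rV[R]_n, 0 <= (x *m H *m x^T) 0 0.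

Definition int01 (f : R -> R) : R :=
  \int[@lebesgue_measure R]_(s in `[0, 1]) f s.

Definition main_field (w : hydro) : hydro :=
  \row_j partial j (fun w' => E1 w' + E2 w') w.

(* Inverse of [main_field] on the half space of positive densities. *)
Definition hydro_of_main : hydro -> hydro :=
  'pinv_(fun=> 0) [set w : hydro | 0 < rho w] main_field.

Definition flux_rho (k : 'I_3) (w : hydro) : R := rho w * vel w k.
Definition flux_mom (i k : 'I_3) (w : hydro) : R :=
  rho w * vel w i * vel w k + pressure w * (i == k)%:R.
Definition flux_rhoS (k : 'I_3) (w : hydro) : R := rho w * ent w * vel w k.

(* Two-point quantities on a face: [ql] and [qr] are the states of the cell and
   of its neighbour, [n] the normal, [eps] the viscosity and [delta] the
   distance of the centers. *)
Section Face.
Variables (ql qr : state) (n : 'I_3 -> R) (eps delta : R).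

Definition face_flux (f : hydro -> R) : R :=
  let pl := main_field (hydro_part ql) in
  let pr := main_field (hydro_part qr) in
  int01 (fun s => f (hydro_of_main (pl + s *: (pr - pl)))).

(* [n] has zero third component, so summing over three directions k is the same
   as summing over the two space directions. *)
Definition fluct (f : 'I_3 -> hydro -> R) : R :=
  \sum_(k < 3) (face_flux (f k) - f k (hydro_part ql)) * n k.

Definition D_rho : R := fluct flux_rho.
Definition D_mom (i : 'I_3) : R := fluct (flux_mom i).
Definition D_rhoS : R := fluct flux_rhoS.

Definition g_visc (j : 'I_9) : R := eps * ((qr 0 j - ql 0 j) / delta).

Definition mean_hessian : 'M[R]_9 :=
  \matrix_(i, j) int01 (fun s => hessian energy (ql + s *: (qr - ql)) i j).

Definition entropy_production : R :=
  2^-1 * eps * (temperature ql)^-1 *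
  ((qr - ql) *m mean_hessian *m (delta^-1 *: (qr - ql))^T) 0 0.

Definition avg (a : state -> R) : R := 2^-1 * (a ql + a qr).

Definition mu (q : state) : R := 2^-1 * \sum_(m < 3) mag q m * mag q m.
Definition maxwell (i k : 'I_3) (q : state) : R := - (mag q i * mag q k).

Definition mu_face : R := avg mu.
Definition maxwell_face (i k : 'I_3) : R :=
  - (avg (mag^~ i) * avg (mag^~ k)).
Definition v_face (i : 'I_3) : R := avg (vel^~ i).
Definition vB_face (i k : 'I_3) : R := avg (fun q => vel q i * mag q k).
Definition Bv_face (i k : 'I_3) : R := avg (mag^~ i) * avg (vel^~ k).

Definition D_B (i : 'I_3) : R :=
  \sum_(k < 3) (Bv_face i k - mag ql i * vel ql k) * n k
  - \sum_(k < 3) (vB_face i k - vel ql i * mag ql k) * n k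
  + 2^-1 * v_face i * \sum_(k < 3) (mag qr k - mag ql k) * n k.

Definition rho_face : R := avg rho.
Definition phi_face : R :=
  (rho ql * phi ql + rho qr * phi qr) / (rho ql + rho qr).

Definition u_tilde : R :=
  let den := avg (fun q => rho q * phi q) * (phi qr - phi ql) in
  if den != 0 then
    (\sum_(k < 3) face_flux (flux_rho k) * n k) * (e4 qr - e4 ql) / den
  else \sum_(k < 3) v_face k * n k.

Definition rhs_rho : R := - D_rho + g_visc j_rho.

Definition rhs_mom (i : 'I_3) : R :=
  - D_mom i - (mu_face - mu ql) * n i
  - \sum_(k < 3) (maxwell_face i k - maxwell i k ql) * n k
  + g_visc (j_mom i).

Definition rhs_rhoS : R := - D_rhoS + g_visc j_rhoS + entropy_production.

Definition rhs_B (i : 'I_3) : R :=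
  - D_B i - ch * (phi_face - phi ql) * n i + g_visc (j_B i).

Definition rhs_phi : R :=
  - (2^-1 * u_tilde * (phi qr - phi ql))
  - ch / rho_face * (2^-1 * \sum_(k < 3) (mag qr k - mag ql k) * n k)
  + g_visc j_phi.

End Face.

Variables (M : mesh R) (eps : R -> allcell M -> allcell M -> R).

(* [q t l] is the state of the cell [l] at time [t], prescribed for ghost cells;
   [eps t l r] is the viscosity, possibly depending on the solution. *)
Definition face_sum (q : R -> allcell M -> state) (t : R) (l : cell M)
    (F : state -> state -> ('I_3 -> R) -> R -> R -> R) : R :=
  (cell_area l)^-1 *
  \sum_(r in nbr l) face_length l r *
    F (q t (inl l)) (q t r) (normal (inl l) r) (eps t (inl l) r)
      (cdist (inl l) r).

Definition scheme_at (q : R -> allcell M -> state) (t : R) (l : cell M) : Prop :=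
  [/\ (fun s => rho (q s (inl l)))^`()%classic t
        = face_sum q t l rhs_rho,
      forall i, (fun s => mom (q s (inl l)) i)^`()%classic t
        = face_sum q t l (fun ql qr n e d => rhs_mom ql qr n e d i),
      (fun s => rhoS (q s (inl l)))^`()%classic t
        = face_sum q t l rhs_rhoS,
      forall i, (fun s => mag (q s (inl l)) i)^`()%classic t
        = face_sum q t l (fun ql qr n e d => rhs_B ql qr n e d i)
    & (fun s => phi (q s (inl l)))^`()%classic t
        = face_sum q t l rhs_phi].

Definition solution (I : set R) (q : R -> allcell M -> state) : Prop :=
  forall t, I t ->
    (forall r : allcell M, 0 < rho (q t r)) /\
    (forall l : cell M,
       derivable (fun s => q s (inl l)) t 1 /\ scheme_at q t l).

Definition viscosity (I : set R) : Prop :=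
  forall t, I t -> forall (l : cell M) (r : allcell M), r \in nbr l ->
    eps t (inl l) r = eps t r (inl l) /\ 0 <= eps t (inl l) r.

End Model.

(* Main.v *)
(* Inserting the equation for [rhoS], the fluctuations and the viscous fluxes
   cancel; what remains is a nonnegative combination over the faces of the
   entropy productions, each a nonnegative multiple of the quadratic form of the
   averaged Hessian. *)
Require Import Defs.
From mathcomp Require Import all_boot all_order all_algebra.
From mathcomp Require Import all_classical all_reals all_analysis.
From mathcomp Require Import ring.
Set Implicit Arguments.
Unset Strict Implicit.
Unset Printing Implicit Defensive.
Import Order.TTheory GRing.Theory Num.Theory.
Import numFieldNormedType.Exports.
Local Open Scope classical_set_scope.
Local Open Scope ring_scope.

Lemma dist2_ge0 (R : realType) (x y : R * R) : 0 <= dist2 x y.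
Proof. exact: sqrtr_ge0. Qed.

(** [fine] sends an infinite value to 0, so the sign of the measure passes to [area] without a
    finiteness argument. *)
Lemma cell_area_ge0 (R : realType) (M : mesh R) (l : cell M) : 0 <= cell_area l.
Proof. exact/fine_ge0/measure_ge0. Qed.

(** By linearity [delta^-1] leaves the transposed vector; what remains is the quadratic form of
    [mean_hessian] at the jump [qr - ql], times nonnegative scalars. Weak signs suffice because
    [0^-1 = 0]. *)
Lemma entropy_production_ge0 (R : realType) (gamma cv eps delta : R)
    (ql qr : 'rV[R]_9) :
  0 <= eps -> 0 <= delta -> 0 <= temperature gamma cv ql ->
  psd (mean_hessian gamma cv ql qr) ->
  0 <= entropy_production gamma cv ql qr eps delta.
Proof.
move=> eps0 delta0 T0 H0; rewrite /entropy_production.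
rewrite linearZ /= -scalemxAr mxE.
by rewrite !mulr_ge0 ?invr_ge0//; exact: H0.
Qed.

Theorem theorem1 (R : realType) (M : mesh R) (gamma cv ch : R)
    (gamma_gt1 : 1 < gamma) (cv_gt0 : 0 < cv) (ch_ge0 : 0 <= ch)
    (I : set R) (I_open : open I) (I_itv : is_interval I)
    (eps : R -> allcell M -> allcell M -> R) (eps_visc : viscosity eps I)
    (q : R -> allcell M -> 'rV[R]_9)
    (q_sol : solution gamma cv ch eps I q)
    (T_gt0 : forall t (r : allcell M), I t -> 0 < temperature gamma cv (q t r))
    (H_psd : forall t (l : cell M) (r : allcell M), I t -> r \in nbr l ->
       psd (mean_hessian gamma cv (q t (inl l)) (q t r))) :
  forall t (l : cell M), I t ->
    0 <= (fun s => rhoS (q s (inl l)))^`()%classic t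
      + \sum_(r in nbr l) face_length l r / cell_area l *
          D_rhoS gamma cv (q t (inl l)) (q t r) (normal (inl l) r)
      - \sum_(r in nbr l) face_length l r / cell_area l *
          g_visc (q t (inl l)) (q t r) (eps t (inl l) r) (cdist (inl l) r)
            j_rhoS.
Proof.
move=> t l It.
have [_ /(_ l) [_ [_ _ -> _ _]]] := q_sol t It.
(* The three sums over [nbr l] become one, so the sign can be checked face by face. *)
rewrite /face_sum mulr_sumr -big_split -sumrB /=.
apply: sumr_ge0 => r lr.
have [_ eps0] := eps_visc t It l r lr.
(* Both sides are linear in [(cell_area l)^-1], which acts as an atom: no quotient has to be
   cancelled. *)
rewrite (_ : _ - _ = (cell_area l)^-1 * (face_length l r *
  entropy_production gamma cv (q t (inl l)) (q t r) (eps t (inl l) r)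
    (cdist (inl l) r))); last by rewrite /rhs_rhoS; ring.
apply: mulr_ge0; first by rewrite invr_ge0 cell_area_ge0.
apply: mulr_ge0; first exact: dist2_ge0.
apply: entropy_production_ge0 => //; first exact: dist2_ge0.
- exact/ltW/T_gt0.
- exact: H_psd.
Qed.
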